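(* Let $i\ge1$ with $i\le\frac{2}{7}\left(r+\frac{5}{2}\right)$. Then there exists an injective map $\phi$ from the set of $(i-1)$-subsets of $[r]$ to the set of $i$-subsets of $[r]$ such that $\phi(T)$ dominates $T$ for every $(i-1)$-subset $T$.
   Context: For $\pi=a_1\cdots a_{r+1}\in S_{r+1}$, its descent set is $\{j\in[r]:a_j>a_{j+1}\}$, and $D(S)$ is the set of permutations in $S_{r+1}$ with descent set $S$. The inversion set is $I(\pi)=\{(a_j,a_k):j<k,\ a_j>a_k\}$; $\pi\le_w\pi'$ iff $I(\pi)\subseteq I(\pi')$ (weak Bruhat order). $S$ dominates $T$ if there is an injection $\psi:D(T)\to D(S)$ with $\pi\le_w\psi(\pi)$ for all $\pi\in D(T)$. *)

(* Defs.v *)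
From mathcomp Require Import all_boot all_fingroup.
Set Implicit Arguments. Unset Strict Implicit. Unset Printing Implicit Defensive.

(* Conventions: [r] = {1,...,r} is represented by 'I_r (element j stands for j+1);
   S_{r+1} is {perm 'I_r.+1}; position p (1-based) of a one-line word a_1...a_{r+1}
   is the ordinal p-1, and a_p = s (p-1) (values are shifted down by 1, which does
   not affect comparisons). *)

(* descent set: j (i.e. position j+1 in [r]) is a descent iff a_{j+1} > a_{j+2} *)
Definition descent_set (r : nat) (s : {perm 'I_r.+1}) : {set 'I_r} :=
  [set j : 'I_r | s (lift ord0 j) < s (widen_ord (leqnSn r) j)].

Definition Dset (r : nat) (S : {set 'I_r}) : {set {perm 'I_r.+1}} :=
  [set s | descent_set s == S].

Definition inv_set (n : nat) (s : {perm 'I_n}) : {set 'I_n * 'I_n} :=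
  [set v : 'I_n * 'I_n | [exists j : 'I_n, exists k : 'I_n,
     [&& j < k, s k < s j & v == (s j, s k)]]].

Definition weak_le (n : nat) (s t : {perm 'I_n}) : bool :=
  inv_set s \subset inv_set t.

Definition dominates (r : nat) (S T : {set 'I_r}) : Prop :=
  exists psi : {perm 'I_r.+1} -> {perm 'I_r.+1},
    {in Dset T &, injective psi} /\
    (forall s, s \in Dset T -> psi s \in Dset S /\ weak_le s (psi s)).

(* Main.v *)
Require Import Defs.
From mathcomp Require Import all_boot all_fingroup zify.

(** View a subset [T] of [[r]] as a set of cuts of the positions [0 .. r] into
    ascending runs. Adding a cut [j] to [T] yields a dominating set in three cases:
    - no neighbour of [j] is a cut (exchange the letters at [j] and [j + 1]);
    - [j] comes just before the last letter of a run of length at least 4 that is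
      followed by a run of length at least 2;
    - the same for a run of length exactly 3 preceded by a run of length at least
      2 and followed by one of length at least 3.
    In each case only the letters of a window of at most 8 positions move, the
    two letters at the ends of the window stay in place, and the injection depends
    only on the relative order of the letters in the window; so domination reduces
    to finding, by computation, a matching between permutations of at most 8 letters.

    Going through the runs from left to right, long runs that carry no cut of the
    second or third kind are compensated by neighbouring short ones, whence a set
    [T] of [i - 1] cuts with [7 i <= 2 r + 5] has at least [i] addable cuts. On the
    other hand a set of size [i] arises from at most [i] sets of size [i - 1], so
    Hall's theorem gives the injection [phi]. *)

Set Implicit Arguments. Unset Strict Implicit. Unset Printing Implicit Defensive.

(** * Hall's theorem *)

Definition nbrs (X Y : finType) (E : X -> pred Y) (B : {set X}) : {set Y} :=
  [set y | [exists x in B, E x y]].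

Lemma nbrsP (X Y : finType) (E : X -> pred Y) (B : {set X}) y :
  reflect (exists2 x, x \in B & E x y) (y \in nbrs E B).
Proof. by rewrite inE; apply: exists_inP. Qed.

(** Induction on [#|A|]: a critical proper subset is matched first and the rest of [A] outside its
    neighbours; with no critical subset, any edge at one element may be fixed. [y0] is the value for
    empty [A]. *)
Lemma hall_matching (X Y : finType) (y0 : Y) (E : X -> pred Y) (A : {set X}) :
  (forall B : {set X}, B \subset A -> #|B| <= #|nbrs E B|) ->
  exists f : X -> Y, {in A &, injective f} /\ {in A, forall x, E x (f x)}.
Proof.
have [n] := ubnP #|A|; elim: n => // n IHn in E A * => ltAn hallA.
have [->|[x0 x0A]] := set_0Vmem A.
  by exists (fun=> y0); split=> x; rewrite inE.
have [/exists_inP[B sBA] | /exists_inPn nocrit] :=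
    boolP [exists (B : {set X} | B \proper A), (B != set0) && (#|nbrs E B| <= #|B|)].
  case/andP=> B0 critB; have ltBA := proper_card sBA.
  have [|B' sB'|f [injf Ef]] := IHn E B; first exact: leq_trans ltBA _.
    by apply: hallA; apply: subset_trans sB' (proper_sub sBA).
  pose E' x : pred Y := fun y => E x y && (y \notin nbrs E B).
  have cardAB : #|A :\: B| + #|B| = #|A|.
    by rewrite -(cardsID B A) (setIidPr (proper_sub sBA)) addnC.
  have B_gt0 : 0 < #|B| by rewrite card_gt0.
  have [||g [injg Eg]] := IHn E' (A :\: B); first by lia.
    move=> C sC.
    have disjCB : C :&: B = set0.
      apply/setP=> x; rewrite !inE; apply/negbTE/negP=> /andP[xC xB].
      by have := subsetP sC _ xC; rewrite inE xB.
    have sCBA : C :|: B \subset A.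
      by rewrite subUset (subset_trans sC (subsetDl _ _)) (proper_sub sBA).
    (* Hall's condition for [C :|: B], less the at most [#|B|] neighbours of [B], gives that of [C]
       under [E']. *)
    have := hallA _ sCBA; rewrite cardsU disjCB cards0 subn0.
    have sN : nbrs E (C :|: B) \subset nbrs E' C :|: nbrs E B.
      apply/subsetP=> y /nbrsP[x xCB Exy]; rewrite in_setU.
      have [//|yNB] := boolP (y \in nbrs E B); first by rewrite orbT.
      rewrite orbF; apply/nbrsP; exists x; last exact/andP.
      move: xCB; rewrite inE => /orP[//|xB].
      by case/negP: yNB; apply/nbrsP; exists x.
    have := leq_trans (subset_leq_card sN) (leq_card_setU _ _); lia.
  exists (fun x => if x \in B then f x else g x); split.
    have fB x : x \in B -> f x \in nbrs E B.
      by move=> xB; apply/nbrsP; exists x => //; apply: Ef.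
    have gB x : x \in A -> x \notin B -> g x \notin nbrs E B.
      by move=> xA xB; have /andP[] : E' x (g x) by apply: Eg; rewrite inE xB.
    move=> x y xA yA; case: ifPn => xB; case: ifPn => yB.
    - exact: injf.
    - by move=> e; case/negP: (gB y yA yB); rewrite -e fB.
    - by move=> e; case/negP: (gB x xA xB); rewrite e fB.
    - by apply: injg; rewrite inE ?xB ?yB.
  move=> x xA; case: ifPn => xB; first exact: Ef.
  by have /andP[] : E' x (g x) by apply: Eg; rewrite inE xB.
have /card_gt0P[z /nbrsP[_ /set1P-> Ez]] : 0 < #|nbrs E [set x0]|.
  by apply: leq_trans (hallA _ _); rewrite ?cards1 ?sub1set.
pose E' x : pred Y := fun y => E x y && (y != z).
have cardA := cardsD1 x0 A; rewrite x0A in cardA.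
(* With no critical subset, each nonempty [C] has a neighbour to spare and can lose [z]. *)
have [||g [injg Eg]] := IHn E' (A :\ x0); first by lia.
  move=> C sC; have [->|C0] := eqVneq C set0; first by rewrite cards0.
  have pCA : C \proper A.
    apply/properP; split; first exact: subset_trans sC (subsetDl _ _).
    by exists x0 => //; apply/negP=> /(subsetP sC); rewrite !inE eqxx.
  have := nocrit C pCA; rewrite C0 /= -ltnNge => ltC.
  have sN : nbrs E C :\ z \subset nbrs E' C.
    apply/subsetP=> y /setD1P[yz /nbrsP[x xC Exy]].
    by apply/nbrsP; exists x => //; apply/andP.
  have := subset_leq_card sN; have := cardsD1 z (nbrs E C).
  by case: (z \in _) => /=; lia.
exists (fun x => if x == x0 then z else g x).
have gE x : x \in A -> x != x0 -> E' x (g x) by move=> *; apply: Eg; apply/setD1P.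
split=> [x y xA yA|x xA].
  case: eqVneq => [->|xx0]; case: eqVneq => [->|yx0] //.
  - by move=> e; have /andP[_] := gE y yA yx0; rewrite -e eqxx.
  - by move=> e; have /andP[_] := gE x xA xx0; rewrite e eqxx.
  - by apply: injg; apply/setD1P.
by case: eqVneq => [->//|xx0]; have /andP[] := gE x xA xx0.
Qed.

(** Double counting of the edges that leave [B]: at least [d] per element of [B], at most [d] per
    neighbour. *)
Lemma degree_matching (X Y : finType) (y0 : Y) (E : X -> pred Y) (A : {set X}) d :
  0 < d -> {in A, forall x, d <= #|[set y | E x y]|} ->
  (forall y, #|[set x in A | E x y]| <= d) ->
  exists f : X -> Y, {in A &, injective f} /\ {in A, forall x, E x (f x)}.
Proof.
move=> d_gt0 degX degY; apply: hall_matching => // B sBA.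
rewrite -(leq_pmul2r d_gt0).
have -> : #|B| * d = \sum_(x in B) d by rewrite sum_nat_const.
apply: (@leq_trans (\sum_(x in B) \sum_(y in nbrs E B) E x y)).
  apply: leq_sum => x xB; apply: leq_trans (degX x (subsetP sBA x xB)) _.
  rewrite -sum1_card big_mkcond [leqRHS]big_mkcond /=; apply: leq_sum => y _.
  case: ifP => //; rewrite inE => Exy; have -> : y \in nbrs E B by apply/nbrsP; exists x.
  by rewrite Exy.
rewrite exchange_big /= -sum_nat_const; apply: leq_sum => y _.
apply: leq_trans (degY y); rewrite -sum1_card big_mkcond [leqRHS]big_mkcond /=.
apply: leq_sum => x _; rewrite inE; case: ifP => // xB.
by rewrite (subsetP sBA x xB); case: (E x y).
Qed.

(** * Rearranging the letters of a window *)

Definition descents (w : seq nat) : bitseq :=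
  if w is x :: w' then pairmap (fun x y => y < x) x w' else [::].

Fixpoint extensions (D : bitseq) (x : nat) (s : seq nat) : seq (seq nat) :=
  if D is d :: D' then
    flatten [seq [seq y :: w | w <- extensions D' y (rem y s)]
            | y <- [seq y <- s | (y < x) == d]]
  else [:: [::]].

(** Built letter by letter along [D], so that words with other descents are never generated. *)
Definition words (D : bitseq) : seq (seq nat) :=
  let s := iota 0 (size D).+1 in
  flatten [seq [seq x :: w | w <- extensions D x (rem x s)] | x <- s].

Definition inv_le (p q : seq nat) : bool :=
  all (fun k => all (fun l => (nth 0 p l < nth 0 p k) ==>
                              (index (nth 0 p k) q < index (nth 0 p l) q))
                    (iota k.+1 (size p - k.+1))) (iota 0 (size p)).

(* A boundary letter of the window must be kept unless it also is a boundary
   letter of the whole word, which the flags [l] and [r] record. *)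
Definition admissible (l r : bool) (D : bitseq) (p q : seq nat) : bool :=
  [&& descents q == D, inv_le p q, l || (head 0 q == head 0 p)
    & r || (last 0 q == last 0 p)].

Definition rearrange (u p : seq nat) : seq nat := [seq nth 0 p k | k <- u].

(* Rearrangements are tried in order, and later ones may only use patterns which
   are not images yet; without this restriction the map would not be injective. *)
Definition greedy_stage (l r : bool) (D D' : bitseq) tbl (u : seq nat) :=
  tbl ++ [seq (p, rearrange u p) | p <- words D &
    [&& p \notin unzip1 tbl, rearrange u p \notin unzip2 tbl
      & admissible l r D' p (rearrange u p)]].

Definition greedy_table l r D D' (us : seq (seq nat)) : seq (seq nat * seq nat) :=
  foldl (greedy_stage l r D D') [::] us.

(** These checks make lookup in a table a suitable injection, so that the greedy construction itself
    needs no correctness proof. *)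
Definition table_ok (l r : bool) (D D' : bitseq) (tbl : seq (seq nat * seq nat)) : bool :=
  [&& all (fun p => p \in unzip1 tbl) (words D), uniq (unzip2 tbl) &
      all (fun e => perm_eq e.2 (iota 0 (size D).+1) && admissible l r D' e.1 e.2) tbl].

Lemma mem_extensions D x s p :
  perm_eq p s -> pairmap (fun x y => y < x) x p = D -> p \in extensions D x s.
Proof.
elim: p x s D => [|y p IHp] x s [|d D] //= ps [dE DE].
have ys : y \in s by rewrite -(perm_mem ps) mem_head.
apply/flatten_mapP; exists y; first by rewrite mem_filter ys dE eqxx.
by apply/map_f/IHp => //; rewrite -(perm_cons y) (perm_trans ps) ?perm_to_rem.
Qed.

Lemma mem_words D p :
  perm_eq p (iota 0 (size D).+1) -> descents p = D -> p \in words D.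
Proof.
case: p => [/perm_size //|x p] ps dE.
have xs : x \in iota 0 (size D).+1 by rewrite -(perm_mem ps) mem_head.
apply/flatten_mapP; exists x => //; apply/map_f/mem_extensions => //.
by rewrite -(perm_cons x) (perm_trans ps) ?perm_to_rem.
Qed.

Lemma size_descents w : size (descents w) = (size w).-1.
Proof. by case: w => //= x w; rewrite size_pairmap. Qed.

Lemma nth_descents w k : k.+1 < size w ->
  nth false (descents w) k = (nth 0 w k.+1 < nth 0 w k).
Proof.
case: w => //= x w; rewrite ltnS => kw.
by rewrite (nth_pairmap 0).
Qed.

Lemma inv_leP p q k l : inv_le p q -> k < l < size p -> nth 0 p l < nth 0 p k ->
  index (nth 0 p k) q < index (nth 0 p l) q.
Proof.
move=> /allP pq kl; have /pq/allP/(_ l) : k \in iota 0 (size p).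
  by rewrite mem_iota; lia.
by move=> H; apply/implyP; apply: H; rewrite mem_iota; lia.
Qed.

(** * Standardization: the relative order of the letters of a window *)

Definition pattern (g : nat -> nat) (m : nat) : seq nat :=
  mkseq (fun k => count (fun l => g l < g k) (iota 0 m)) m.

Lemma count_lt_iota a m : a <= m -> count (fun v => v < a) (iota 0 m) = a.
Proof.
move=> am; rewrite -(subnKC am) iotaD count_cat.
rewrite (_ : count _ (iota 0 a) = size (iota 0 a)).
  rewrite (_ : count _ _ = 0) ?size_iota ?addn0 //.
  by apply/eqP; rewrite -leqn0 leqNgt -has_count; apply/hasP => -[x]; rewrite mem_iota; lia.
by apply/eqP; rewrite -all_count; apply/allP => x; rewrite mem_iota; lia.
Qed.

(** If [g k < g l], the positions counted for [k], together with [k] itself, are all counted for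
    [l]. *)
Lemma pattern_ltn g m k l : k < m -> l < m ->
  (nth 0 (pattern g m) k < nth 0 (pattern g m) l) = (g k < g l).
Proof.
move=> km lm; rewrite !nth_mkseq //; case: (ltnP (g k) (g l)) => [kl | lk].
  apply: leq_trans (_ : count (predU (fun i => g i < g k) (pred1 k)) (iota 0 m) <= _).
    have := count_predUI (fun i => g i < g k) (pred1 k) (iota 0 m).
    rewrite (count_uniq_mem k (iota_uniq 0 m)) mem_iota km.
    rewrite (@eq_count _ (predI _ _) pred0) ?count_pred0 => [|i /=]; first by lia.
    by apply/negbTE/negP => /andP[+ /eqP e]; rewrite e ltnn.
  by apply: sub_count => i /= /orP[/ltn_trans->//|/eqP->].
by apply/negbTE; rewrite -leqNgt; apply: sub_count => i /= /leq_trans; apply.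
Qed.

Lemma pattern_perm g m : {in [pred k | k < m] &, injective g} ->
  perm_eq (pattern g m) (iota 0 m).
Proof.
move=> injg; have uniqp : uniq (pattern g m).
  apply/(uniqP 0) => k l; rewrite !inE size_mkseq => km lm e; apply: injg => //.
  by case: (ltngtP (g k) (g l)) => //; rewrite -(@pattern_ltn g m) // e ltnn.
rewrite uniq_perm ?iota_uniq //.
apply: (uniq_min_size uniqp _ _).2; last by rewrite size_mkseq size_iota.
move=> _ /mapP[k km ->]; rewrite mem_iota /= add0n.
rewrite -[ltnRHS](size_iota 0) -(count_predC (fun l => g l < g k) (iota 0 m)).
rewrite -[ltnLHS]addn0 ltn_add2l -has_count; apply/hasP; exists k => //=.
by rewrite ltnn.
Qed.

(** A permutation of [0 .. m - 1] is its own standardization, since the letter [v] has exactly [v]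
    smaller ones. *)
Lemma pattern_order_iso g m q : perm_eq q (iota 0 m) ->
  {in [pred k | k < m] &, forall k l, (g k < g l) = (nth 0 q k < nth 0 q l)} ->
  pattern g m = q.
Proof.
move=> qs gq; have szq : size q = m by rewrite (perm_size qs) size_iota.
apply: (@eq_from_nth _ 0) => [|k]; rewrite size_mkseq ?szq // => km.
rewrite nth_mkseq //.
transitivity (count (fun v => v < nth 0 q k) q).
  rewrite -[in RHS](mkseq_nth 0 q) szq count_map; apply: eq_in_count => l.
  by rewrite mem_iota add0n => /= lm; rewrite nth_mkseq // gq.
rewrite (seq.permP qs) count_lt_iota //.
have : nth 0 q k \in q by rewrite mem_nth ?szq.
by rewrite (perm_mem qs) mem_iota => /andP[_ /ltnW].
Qed.

(** The old position of the letter that lands at [x] when the window at [o] changes its pattern from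
    [p] to [q]. *)
Definition reindex (o : nat) (p q : seq nat) (x : nat) : nat :=
  if o <= x < o + size p then o + index (nth 0 q (x - o)) p else x.

Lemma reindex_in o p q x : perm_eq p q -> o <= x < o + size p ->
  o <= reindex o p q x < o + size p /\
  nth 0 p (reindex o p q x - o) = nth 0 q (x - o).
Proof.
move=> pq xw; rewrite /reindex xw addKn leq_addr ltn_add2l index_mem.
have xq : nth 0 q (x - o) \in p.
  by rewrite (perm_mem pq) mem_nth // -(perm_size pq); lia.
by rewrite xq nth_index.
Qed.

Lemma reindex_out o p q x : ~~ (o <= x < o + size p) -> reindex o p q x = x.
Proof. by rewrite /reindex => /negbTE->. Qed.

Lemma reindex_window o p q x : perm_eq p q ->
  (o <= reindex o p q x < o + size p) = (o <= x < o + size p).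
Proof.
move=> pq; have [xw|xw] := boolP (o <= x < o + size p).
  by have [-> _] := reindex_in pq xw.
by rewrite reindex_out // (negbTE xw).
Qed.

Lemma reindex_inj o p q : perm_eq p q -> uniq q -> injective (reindex o p q).
Proof.
move=> pq uq x y e; have := reindex_window o x pq; rewrite e reindex_window //.
have [xw|xw] := boolP (o <= x < _) => yw; last first.
  by move: e; rewrite !reindex_out // yw.
have [_ ex] := reindex_in pq xw; have [_ ey] := reindex_in pq yw.
have /eqP : nth 0 q (x - o) = nth 0 q (y - o) by rewrite -ex -ey e.
by rewrite nth_uniq ?(perm_size (_ : perm_eq q p)) 1?perm_sym //; lia.
Qed.

Lemma reindex_index o p q x : perm_eq p q -> uniq q -> o <= x < o + size p ->
  index (nth 0 p (reindex o p q x - o)) q = x - o.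
Proof.
move=> pq uq xw; have [_ ->] := reindex_in pq xw.
by rewrite index_uniq // -(perm_size pq); lia.
Qed.

(** A predicate on all of [nat], false from [r] on, so that neighbouring positions need no
    bounds. *)
Definition cut (r : nat) (T : {set 'I_r}) (x : nat) : bool := x \in map val (enum T).

Lemma cut_ord r (T : {set 'I_r}) (j : 'I_r) : cut T j = (j \in T).
Proof. by rewrite /cut (mem_map val_inj) mem_enum. Qed.

Lemma cut_lt r (T : {set 'I_r}) x : cut T x -> x < r.
Proof. by case/mapP=> j _ ->; apply: ltn_ord. Qed.

Lemma cutU1 r (T : {set 'I_r}) (j : 'I_r) x : cut (j |: T) x = (x == j) || cut T x.
Proof.
have [xr|rx] := ltnP x r.
  by rewrite -[x]/(val (Ordinal xr)) !cut_ord !inE -val_eqE.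
have out (S : {set 'I_r}) : cut S x = false by apply: contraTF rx => /cut_lt; rewrite ltnNge.
by rewrite !out orbF; apply/esym/negbTE; rewrite neq_ltn (leq_trans (ltn_ord j) rx) orbT.
Qed.

Definition letter (r : nat) (s : {perm 'I_r.+1}) (x : nat) : nat := s (inord x).

Lemma mem_Dset r (T : {set 'I_r}) (s : {perm 'I_r.+1}) :
  s \in Dset T <-> (forall x, x < r -> (letter s x.+1 < letter s x) = cut T x).
Proof.
have descE (j : 'I_r) : (j \in descent_set s) = (letter s j.+1 < letter s j).
  by rewrite inE /letter; congr (s _ < s _); apply: val_inj; rewrite /= inordK //; have := ltn_ord j; lia.
rewrite inE; split=> [/eqP<- x xr|H].
  by rewrite -[x]/(val (Ordinal xr)) cut_ord descE.
by apply/eqP/setP=> j; rewrite descE H ?cut_ord.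
Qed.

Lemma letter_inj r (s : {perm 'I_r.+1}) : {in [pred x | x <= r] &, injective (letter s)}.
Proof.
move=> x y; rewrite !inE => xr yr /val_inj/perm_inj/(congr1 val).
by rewrite /= !inordK.
Qed.

(* The value is meaningless when [h] is not injective. *)
Definition compose_perm (T : finType) (s : {perm T}) (h : T -> T) : {perm T} :=
  odflt s [pick t : {perm T} | [forall x, t x == s (h x)]].

Lemma compose_permE (T : finType) (s : {perm T}) (h : T -> T) x :
  injective h -> compose_perm s h x = s (h x).
Proof.
move=> injh; rewrite /compose_perm; case: pickP => [t /forallP/(_ x)/eqP //|].
move/(_ (perm injh * s)%g)/forallP; case=> y.
by rewrite permM permE.
Qed.

(** An inversion of [s] reappears in [t] as the same pair of values, at the preimages of its
    positions under [h]; the last hypothesis keeps these in order. *)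
Lemma weak_le_compose n (s t : {perm 'I_n}) (h : 'I_n -> 'I_n) :
  injective h -> (forall x, t x = s (h x)) ->
  (forall x y, h x < h y -> s (h y) < s (h x) -> x < y) -> weak_le s t.
Proof.
move=> injh tE hlt; have [h' hK h'K] := injF_bij injh.
apply/subsetP=> v; rewrite !inE => /existsP[j /existsP[k /and3P[jk sjk /eqP->]]].
apply/existsP; exists (h' j); apply/existsP; exists (h' k).
by rewrite !tE !h'K sjk eqxx hlt ?h'K.
Qed.

(** [psi] turns the pattern [p] of the window into [f p]. The image shows [f p], hence [p] and the
    moves made, hence [s]. *)
Lemma window_dominates (r o : nat) (l l' : bool) (D D' : bitseq)
    (f : seq nat -> seq nat) (T S : {set 'I_r}) :
  let m := (size D).+1 in
  o + m <= r.+1 -> (l -> o = 0) -> (l' -> o + m = r.+1) ->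
  (forall p, perm_eq p (iota 0 m) -> descents p = D ->
     perm_eq (f p) (iota 0 m) && admissible l l' D' p (f p)) ->
  (forall p p', perm_eq p (iota 0 m) -> descents p = D ->
     perm_eq p' (iota 0 m) -> descents p' = D -> f p = f p' -> p = p') ->
  (forall k, k < size D -> cut T (o + k) = nth false D k) ->
  (forall k, k < size D -> cut S (o + k) = nth false D' k) ->
  (forall x, x < r -> ~~ (o <= x < o + size D) -> cut S x = cut T x) ->
  dominates S T.
Proof.
move=> m omr lo l'o fP finj TD SD' ST.
pose pat (s : {perm 'I_r.+1}) := pattern (fun k => letter s (o + k)) m.
pose h s (x : 'I_r.+1) : 'I_r.+1 := inord (reindex o (pat s) (f (pat s)) x).
pose psi s := compose_perm s (h s).
have pat_perm s : perm_eq (pat s) (iota 0 m).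
  apply: pattern_perm => k k'; rewrite !inE => km k'm e.
  by have := letter_inj _ _ e; rewrite !inE; lia.
have size_pat s : size (pat s) = m by rewrite (perm_size (pat_perm s)) size_iota.
have pat_lt s x y : o <= x < o + m -> o <= y < o + m ->
    (letter s x < letter s y) = (nth 0 (pat s) (x - o) < nth 0 (pat s) (y - o)).
  by move=> xw yw; rewrite pattern_ltn ?subnKC //; lia.
have pat_desc s : s \in Dset T -> descents (pat s) = D.
  move=> /mem_Dset sT; apply: (@eq_from_nth _ false) => [|k].
    by rewrite size_descents size_pat.
  rewrite size_descents size_pat => kD; rewrite nth_descents ?size_pat //.
  by rewrite pattern_ltn ?addnS ?sT ?TD //; rewrite /m; lia.
have fpat s : s \in Dset T ->
    [/\ perm_eq (f (pat s)) (iota 0 m), perm_eq (pat s) (f (pat s)), uniq (f (pat s)),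
        size (f (pat s)) = m & admissible l l' D' (pat s) (f (pat s))].
  move=> sT; have /andP[fs adm] := fP _ (pat_perm s) (pat_desc s sT).
  split=> //; first by rewrite (perm_trans (pat_perm s)) 1?perm_sym.
    by rewrite (perm_uniq fs) iota_uniq.
  by rewrite (perm_size fs) size_iota.
have re_lt s x : s \in Dset T -> x <= r -> reindex o (pat s) (f (pat s)) x <= r.
  case/fpat=> _ pf _ _ _ xr; have [xw|xw] := boolP (o <= x < o + size (pat s)).
    by have [] := reindex_in pf xw; rewrite size_pat; lia.
  by rewrite reindex_out.
have hE s (x : 'I_r.+1) : s \in Dset T -> val (h s x) = reindex o (pat s) (f (pat s)) x.
  by move=> sT; rewrite /h /= inordK // ltnS re_lt // -ltnS.
have h_inj s : s \in Dset T -> injective (h s).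
  move=> sT x y /(congr1 val); rewrite !hE //; have [_ pf uf _ _] := fpat s sT.
  by move/(reindex_inj pf uf)/val_inj.
have psiE s x : s \in Dset T -> psi s x = s (h s x).
  by move=> sT; apply/compose_permE/h_inj.
have letter_psi s x : s \in Dset T -> x <= r ->
    letter (psi s) x = letter s (reindex o (pat s) (f (pat s)) x).
  by move=> sT xr; rewrite /letter psiE // /h inordK.
have psi_lt s x y : s \in Dset T -> o <= x < o + m -> o <= y < o + m ->
    (letter (psi s) x < letter (psi s) y) =
    (nth 0 (f (pat s)) (x - o) < nth 0 (f (pat s)) (y - o)).
  move=> sT xw yw; have [_ pf _ _ _] := fpat s sT.
  rewrite -(size_pat s) in xw yw.
  have [xw' <-] := reindex_in pf xw; have [yw' <-] := reindex_in pf yw.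
  by rewrite !letter_psi // ?pat_lt -?(size_pat s) //; move: xw yw; rewrite size_pat; lia.
exists psi; split=> [s1 s2 s1T s2T e|s sT].
  have pat_psi s : s \in Dset T -> pattern (fun k => letter (psi s) (o + k)) m = f (pat s).
    move=> sT; have [fs _ _ _ _] := fpat s sT.
    apply: pattern_order_iso => // k k'; rewrite !inE => km k'm.
    by rewrite psi_lt // ?addKn //; lia.
  have ep : pat s1 = pat s2.
    apply: finj; rewrite ?pat_perm ?pat_desc //.
    by rewrite -!pat_psi // e.
  apply/permP=> x; have [g _ gK] := injF_bij (h_inj s1 s1T).
  have eh : h s1 (g x) = h s2 (g x) by rewrite /h ep.
  by rewrite -(gK x) -psiE // e psiE // eh.
have [fs pf uf szf /and4P[/eqP fD' finv fl fr]] := fpat s sT; split; last first.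
  apply: (@weak_le_compose _ _ _ (h s)); first exact: h_inj.
    by move=> x; apply: psiE.
  move=> x y; rewrite !hE // => xy.
  have sE z : val (s (h s z)) = letter s (reindex o (pat s) (f (pat s)) z).
    by rewrite /letter -hE // inord_val.
  rewrite !sE.
  (* Inside the window [inv_le] applies; a pair with a position outside keeps its order because
     [reindex] preserves the window. *)
  have [xw|xw] := boolP (o <= x < o + size (pat s));
    have [yw|yw] := boolP (o <= y < o + size (pat s)).
  - have [xw' _] := reindex_in pf xw; have [yw' _] := reindex_in pf yw.
    rewrite pat_lt -?(size_pat s) // => lt_s.
    set i := reindex _ _ _ x in xy xw' lt_s; set j := reindex _ _ _ y in xy yw' lt_s.
    have ij : i - o < j - o < size (pat s).
      by rewrite size_pat in xw' yw' *; clearbody i j; lia.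
    by have := inv_leP finv ij lt_s; rewrite !reindex_index //; lia.
  - have [+ _] := reindex_in pf xw; move: xy xw yw; rewrite size_pat => xy xw yw xw'.
    by move: xy; rewrite (reindex_out _ (_ : ~~ (o <= y < _))) ?size_pat //; lia.
  - have [+ _] := reindex_in pf yw; move: xy xw yw; rewrite size_pat => xy xw yw yw'.
    by move: xy; rewrite (reindex_out _ (_ : ~~ (o <= x < _))) ?size_pat //; lia.
  - by move: xy; rewrite !reindex_out.
apply/mem_Dset=> x xr; have [xw|xw] := boolP (o <= x < o + size D).
  have szD : x - o < size D by lia.
  rewrite psi_lt ?subSn //; [|lia..].
  rewrite -nth_descents ?szf // fD' -SD' // subnKC //; lia.
rewrite ST // -(mem_Dset T s).1 //.
(* The remaining descents compare letters that stay: those outside the window, and its end letters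
   where it stops short of the end of the word. *)
have keep y : y <= r ->
    [\/ y < o, y = o /\ 0 < o, y = o + size D /\ y < r | o + m <= y] ->
    letter (psi s) y = letter s y.
  move=> yr yo; rewrite letter_psi //; congr letter.
  have [yw|yw] := boolP (o <= y < o + size (pat s)); last by rewrite reindex_out.
  have [rw re] := reindex_in pf yw; rewrite size_pat in rw yw.
  have : nth 0 (pat s) (reindex o (pat s) (f (pat s)) y - o) = nth 0 (pat s) (y - o).
    rewrite re; case: yo => [|[yo o0]|[yo yr']|]; try lia.
      rewrite yo subnn !nth0; apply/eqP; move: fl; case: (l) lo => //.
      by move/(_ isT); lia.
    rewrite yo addKn -[size D]/(m.-1) -{1}szf -(size_pat s) !nth_last.
    apply/eqP; move: fr; case: (l') l'o => //.
    by move/(_ isT); lia.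
  move/eqP; rewrite nth_uniq ?size_pat ?(perm_uniq (pat_perm s)) ?iota_uniq //; lia.
have keepS : letter (psi s) x.+1 = letter s x.+1.
  apply: keep => //; have [?|?] := ltnP x.+1 o; first by constructor 1.
  by have [?|?] := leqP (o + m) x.+1; [constructor 4 | constructor 2; lia].
have keep0 : letter (psi s) x = letter s x.
  apply: keep; first exact: ltnW.
  have [?|?] := ltnP x o; first by constructor 1.
  by have [?|?] := leqP (o + m) x; [constructor 4 | constructor 3; lia].
by rewrite keepS keep0.
Qed.

(** * Counting the addable cuts *)

Definition isolated (b : pred nat) (j : nat) : bool :=
  [&& ~~ b j, (j == 0) || ~~ b j.-1 & ~~ b j.+1].

(** The run ends at position [j + 1]; the inequalities make the window from [j - 2] to [j + 3] fit
    into [0 .. r]. *)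
Definition ends_long_run (r : nat) (b : pred nat) (j : nat) : bool :=
  [&& 2 <= j, j + 2 < r, ~~ b (j - 2), ~~ b (j - 1), ~~ b j, b (j + 1) & ~~ b (j + 2)].

(** The run occupies [j - 1] to [j + 1], in a window from [j - 3] to [j + 4]. *)
Definition ends_run3 (r : nat) (b : pred nat) (j : nat) : bool :=
  [&& 3 <= j, j + 3 < r, ~~ b (j - 3), b (j - 2), ~~ b (j - 1), ~~ b j, b (j + 1),
      ~~ b (j + 2) & ~~ b (j + 3)].

Definition addable (r : nat) (b : pred nat) (j : nat) : bool :=
  [|| isolated b j, ends_long_run r b j | ends_run3 r b j].

(** [o] and [c] refer to the [r.+1] positions of letters, whereas [b x] marks the gap between
    positions [x] and [x.+1]. *)
Definition run (r : nat) (b : pred nat) (o c : nat) : Prop :=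
  [/\ 0 < c, o + c <= r.+1, forall x, o <= x -> x.+1 < o + c -> ~~ b x
    & o + c = r.+1 \/ b (o + c).-1].

Lemma run_exists r b o : o <= r -> exists c, run r b o c.
Proof.
move=> lor; have [n] := ubnP (r - o); elim: n o lor => // n IHn o lor ltn.
have [ro|ro] := leqP r o.
  exists 1; split=> //; [lia | move=> x; lia | left; lia].
have [bo|bo] := boolP (b o).
  exists 1; split=> //; [lia | move=> x; lia | by right; rewrite addn1].
have [||c [c0 cr cb ce]] := IHn o.+1; [lia.. |].
exists c.+1; split=> // [|x ox xc|]; rewrite -?addSnnS //.
by have [->//|ne] := eqVneq x o; apply: cb => //; lia.
Qed.

(** Right ends are compared only when [0 < n'], because [n'] will be a truncated difference such as
    [c - 3]. *)
Lemma count_iota_ge (P : pred nat) o n o' n' :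
  o <= o' -> (0 < n' -> o' + n' <= o + n) -> (forall j, o' <= j < o' + n' -> P j) ->
  n' <= count P (iota o n).
Proof.
case: (posnP n') => [->//|n0] oo' /(_ isT) le_n Pj.
have -> : n = (o' - o) + (n' + (o + n - (o' + n'))) by lia.
rewrite !iotaD !count_cat subnKC //.
have : all P (iota o' n') by apply/allP => j; rewrite mem_iota => /Pj.
by rewrite all_count size_iota => /eqP->; lia.
Qed.

Lemma count_iota_split (P : pred nat) o c r : o + c <= r ->
  count P (iota o (r - o)) = count P (iota o c) + count P (iota (o + c) (r - (o + c))).
Proof. by move=> ocr; rewrite -count_cat -iotaD; congr (count _ (iota _ _)); lia. Qed.

Lemma count_cuts_run r (b : pred nat) o c : run r b o c -> b (o + c).-1 ->
  count b (iota o c) = 1.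
Proof.
case=> c0 _ cb _ be; have -> : c = c.-1 + 1 by lia.
rewrite iotaD count_cat /= (_ : o + c.-1 = (o + c).-1) ?be; last by lia.
have -> : count b (iota o c.-1) = 0; last by [].
apply/eqP; rewrite -leqn0 leqNgt -has_count; apply/hasPn => x; rewrite mem_iota => xc.
by apply: cb; lia.
Qed.

Lemma count_cuts_last r (b : pred nat) o c : run r b o c -> o + c = r.+1 ->
  count b (iota o (r - o)) = 0.
Proof.
case=> c0 _ cb _ be.
apply/eqP; rewrite -leqn0 leqNgt -has_count; apply/hasPn => x; rewrite mem_iota => xc.
by apply: cb; lia.
Qed.

(* [n], [N] and [K] are the numbers of positions, of addable positions and of cuts
   in a final segment that starts with a run of length [c]. The balance
   [2 * N + 5 * K + 3 - 2 * n] gains 3 at an interior run of length 1, gains 1 at one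
   of length 2, and loses 1 at a longer one, unless the latter carries an addable
   cut of the second or third kind, when it gains 1. The equations in [n] and [K]
   come from the alternations 3, 2, ..., 3, 2 and 2, 3, 2, ..., 3, 2, whose balance
   is exceptionally low. *)
Definition suffix_bound (prev2 : Prop) (c n N K : nat) : Prop :=
  [/\ c = 1 -> 2 * n + 2 <= 2 * N + 5 * K + 3,
      c = 2 -> 2 * n + 2 <= 2 * N + 5 * K + 3 \/
               2 * n + 1 <= 2 * N + 5 * K + 3 /\ 2 * n.+1 + 1 = 5 * K.+1,
      4 <= c -> 2 * n + 1 <= 2 * N + 5 * K + 3,
      prev2 -> 2 * n + 1 <= 2 * N + 5 * K + 3 \/
               2 * n <= 2 * N + 5 * K + 3 /\ 2 * n.+1 = 5 * K.+1 /\ 0 < K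
    & 2 * n <= 2 * N + 5 * K + 4].

(** Induction over the runs from the right. In an interior run all positions but the first and the
    last two are isolated. The first argument of [suffix_bound] says that the preceding run has
    length at least 2, as the third kind requires. *)
Lemma suffix_addable r (b : pred nat) o c :
  (forall x, b x -> x < r) -> 0 < o -> o <= r -> b o.-1 -> run r b o c ->
  suffix_bound (1 < o /\ ~~ b (o - 2)) c (r - o)
    (count (addable r b) (iota o (r - o))) (count b (iota o (r - o))).
Proof.
move=> b_lt; have [n] := ubnP (r - o).
elim: n o c => // n IHn o c ltn o0 lor bo runc; have [c0 ocr cb ce] := runc.
have iso j : o < j -> j.+2 < o + c -> isolated b j.
  by move=> oj jc; rewrite /isolated (cb j) ?(cb j.+1) ?(cb j.-1) ?orbT //; lia.
case: ce => [ce|be].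
  rewrite (count_cuts_last runc ce).
  (* [c - 2] rather than [c - 3]: no cut closes the last run. *)
  have : c - 2 <= count (addable r b) (iota o (r - o)).
    apply: (@count_iota_ge _ _ _ o.+1); [lia.. | move=> j jw].
    have nb : ~~ b j.+1.
      have [jr|jr] := ltnP j.+1 r; first by apply: cb; lia.
      by apply/negP=> /b_lt; lia.
    by rewrite /addable /isolated (cb j) ?(cb j.-1) ?nb ?orbT //; lia.
  by move: (count _ _) => N HN; split=> *; lia.
have ocr' : o + c <= r by have := b_lt _ be; lia.
have [d rund] := run_exists b ocr'; have [d0 odr db _] := rund.
have [||] := IHn _ _ _ _ ocr' be rund; [lia.. |].
rewrite !(count_iota_split _ ocr') (count_cuts_run runc be).
have -> : r - o = c + (r - (o + c)) by lia.
set N' := count (addable r b) (iota (o + c) _); set K' := count b (iota (o + c) _).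
have prev2' : 1 < c -> 1 < o + c /\ ~~ b (o + c - 2).
  by move=> c1; split; [lia | apply: cb; lia].
have cnt : c - 3 <= count (addable r b) (iota o c).
  apply: (@count_iota_ge _ _ _ o.+1); [lia.. | move=> j jw].
  by rewrite /addable iso //; lia.
have cntX : addable r b (o + c - 2) -> 2 < c ->
    c - 2 <= count (addable r b) (iota o c).
  move=> add c2; apply: (@count_iota_ge _ _ _ o.+1); [lia.. | move=> j jw].
  have [jE|jE] := eqVneq j (o + c - 2); first by rewrite jE.
  by rewrite /addable iso //; lia.
have cntA : 4 <= c -> 2 <= d -> c - 2 <= count (addable r b) (iota o c).
  move=> c4 d2; apply: cntX; last by lia.
  apply/orP; right; apply/orP; left.
  have -> : o + c - 2 = (o + c).-2 by lia.
  rewrite /ends_long_run.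
  have -> : (o + c).-2 + 1 = (o + c).-1 by lia.
  have -> : (o + c).-2 + 2 = o + c by lia.
  rewrite be (db (o + c)) ?(cb (o + c).-2) ?(cb ((o + c).-2 - 1)) ?(cb ((o + c).-2 - 2)) //; lia.
have cntB : c = 3 -> 3 <= d -> 1 < o /\ ~~ b (o - 2) ->
    c - 2 <= count (addable r b) (iota o c).
  move=> c3 d3 [o1 bo2]; apply: cntX; last by lia.
  apply/orP; right; apply/orP; right; move: be db odr; rewrite c3 => be db odr.
  rewrite /ends_run3.
  have -> : o + 3 - 2 - 3 = o - 2 by lia.
  have -> : o + 3 - 2 - 2 = o.-1 by lia.
  have -> : o + 3 - 2 + 1 = (o + 3).-1 by lia.
  rewrite bo bo2 be (cb (o + 3 - 2)) ?(cb (o + 3 - 2 - 1)) ?(db (o + 3 - 2 + 2)) ?(db (o + 3 - 2 + 3)) //; lia.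
move: (count _ (iota o c)) cnt cntA cntB => N cnt cntA cntB {cntX iso}.
clearbody N' K'; move: (r - (o + c)) => n' V1 V2 V4 Vp V.
(* The cases are, in turn, [c = 1], [c = 2], [d = 1], [4 <= c], [d = 2], and last [c = 3 <= d],
   where [cntB] applies if the preceding run is long enough. *)
have [c1|c1] := leqP c 1; first by split=> *; lia.
have {prev2' cb be runc IHn db b_lt}Vp' := Vp (prev2' c1).
have [c2|c2] := eqVneq c 2; first by split=> *; lia.
have [d1|d1] := leqP d 1; first by have {}V1 := V1 ltac:(lia); split=> *; lia.
have [c4|c3] := leqP 4 c; first by have {}cntA := cntA c4 d1; split=> *; lia.
have [d2|d2] := eqVneq d 2; first by have {}V2 := V2 d2; split=> *; lia.
by split=> *; lia.
Qed.

(** No cut precedes the first run, so position [0] can be isolated as well; this extra contribution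
    is added to the bound for the remaining runs. *)
Lemma many_addable r (b : pred nat) :
  (forall x, b x -> x < r) -> 7 * count b (iota 0 r) + 2 <= 2 * r ->
  count b (iota 0 r) < count (addable r b) (iota 0 r).
Proof.
move=> b_lt; have [c runc] := run_exists b (leq0n r); have [c0 ocr cb ce] := runc.
have -> : iota 0 r = iota 0 (r - 0) by rewrite subn0.
case: ce => [ce|be].
  have -> := count_cuts_last runc ce; rewrite subn0 => r1.
  apply: leq_trans (_ : r <= _); first by lia.
  apply: (@count_iota_ge _ _ _ 0) => // j jr; rewrite /addable /isolated.
  have nb x : ~~ b x.
    have [xr|xr] := ltnP x r; first by apply: cb; lia.
    by apply/negP=> /b_lt; lia.
  by rewrite !nb orbT.
have cr : 0 + c <= r by have := b_lt _ be; lia.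
have [d rund] := run_exists b cr; have [d0 odr db _] := rund.
have [//|] := suffix_addable b_lt _ cr be rund.
rewrite !(count_iota_split _ cr) (count_cuts_run runc be).
set N' := count (addable r b) (iota (0 + c) _); set K' := count b (iota (0 + c) _).
rewrite !add0n in be cb db odr cr N' K' *.
have cnt : c - 2 <= count (addable r b) (iota 0 c).
  apply: (@count_iota_ge _ _ _ 0) => //; first by lia.
  move=> j jw; rewrite /addable /isolated (cb j) ?(cb j.+1) //; try lia.
  by case: j jw => //= j jw; rewrite (cb j) //; lia.
have cntA : 4 <= c -> 2 <= d -> c - 1 <= count (addable r b) (iota 0 c).
  move=> c4 d2; apply: (@count_iota_ge _ _ _ 0) => //; first by lia.
  move=> j jw; have [jE|jE] := eqVneq j (c - 2); last first.
    rewrite /addable /isolated (cb j) ?(cb j.+1) //; try lia.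
    by case: j jw {jE} => //= j jw; rewrite (cb j) //; lia.
  apply/orP; right; apply/orP; left.
  rewrite /ends_long_run.
  have -> : j + 1 = c.-1 by lia.
  have -> : j + 2 = c by lia.
  by rewrite be (db c) ?(cb j) ?(cb (j - 1)) ?(cb (j - 2)) //; lia.
have prev2 : 1 < c -> 1 < c /\ ~~ b (c - 2).
  by move=> c1; split; [lia | apply: cb; lia].
move: (count _ (iota 0 c)) cnt cntA => N cnt cntA.
clearbody N' K'; move: (r - c) (subnKC cr) => n' rE V1 V2 V4 Vp V.
have [c1|c1] := leqP c 1; first by lia.
have {prev2}Vp' := Vp (prev2 c1).
(* In the exceptional alternative of [Vp'] the hypothesis gives [K' + 1 <= c - 2], so [0 < K']
   forces [4 <= c]; then [V1] or [cntA] suffices, according to [d]. *)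
lia.
Qed.

(** * Adding a cut *)

(** Reduces domination to one closed boolean computation; the injection on patterns is lookup in the
    table. *)
Lemma greedy_dominates r o l l' (D : bitseq) us (T : {set 'I_r}) (j : 'I_r) :
  let D' := set_nth false D (j - o) true in
  table_ok l l' D D' (greedy_table l l' D D' us) ->
  o + (size D).+1 <= r.+1 -> (l -> o = 0) -> (l' -> o + (size D).+1 = r.+1) ->
  o <= j < o + size D ->
  (forall k, k < size D -> cut T (o + k) = nth false D k) ->
  dominates (j |: T) T.
Proof.
move=> D'; set tbl := greedy_table _ _ _ _ _ => /and3P[/allP dom uniq2 /allP ok] oDr lo l'o jw TD.
pose f p := nth [::] (unzip2 tbl) (index p (unzip1 tbl)).
have mem1 p : perm_eq p (iota 0 (size D).+1) -> descents p = D -> p \in unzip1 tbl.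
  by move=> ps pD; apply: dom; apply: mem_words.
have size12 : size (unzip2 tbl) = size (unzip1 tbl) by rewrite !size_map.
apply: (@window_dominates r o l l' D D' f) => //.
- move=> p ps pD; have p1 := mem1 p ps pD.
  have idx : index p (unzip1 tbl) < size tbl by rewrite -(size_map fst) index_mem.
  have := ok _ (mem_nth ([::], [::]) idx).
  have -> : f p = (nth ([::], [::]) tbl (index p (unzip1 tbl))).2.
    by rewrite /f (nth_map ([::], [::])).
  suff -> : (nth ([::], [::]) tbl (index p (unzip1 tbl))).1 = p by [].
  by rewrite -(nth_map _ [::]) ?nth_index.
- move=> p p' ps pD ps' pD' /eqP.
  have p1 := mem1 p ps pD; have p1' := mem1 p' ps' pD'.
  rewrite /f nth_uniq ?size12 ?index_mem // => /eqP e.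
  by rewrite -(nth_index [::] p1) e nth_index.
- move=> k kD; rewrite cutU1 TD // nth_set_nth /=.
  have -> : (o + k == j) = (k == j - o) by lia.
  by case: eqP.
- move=> x xr xw; rewrite cutU1; case: eqP => // xj.
  by case/negP: xw; rewrite xj.
Qed.

(** The letters of the window increase, so a single pattern has to be treated. The cases shorten the
    window where [j] is next to an end of the word. *)
Lemma isolated_dominates r (T : {set 'I_r}) (j : 'I_r) :
  isolated (cut T) j -> dominates (j |: T) T.
Proof.
case/and3P=> b0 bp bn; have jr := ltn_ord j.
have [j0|j0] := posnP j.
  rewrite j0 in b0 bn; have [jr'|jr'] := leqP r j.+1.
    apply: (@greedy_dominates _ 0 true true [:: false] [:: [:: 1; 0]]);
      rewrite ?j0 //=; try lia.
    by case=> // _; apply/negbTE.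
  apply: (@greedy_dominates _ 0 true false [:: false; false] [:: [:: 1; 0; 2]]);
    rewrite ?j0 //=; try lia.
  by case=> [|[|//]] _; apply/negbTE.
have {}bp : ~~ cut T j.-1 by move: bp; rewrite gtn_eqF.
have jp : j - j.-1 = 1 by lia.
have [jr'|jr'] := leqP r j.+1.
  apply: (@greedy_dominates _ j.-1 false true [:: false; false] [:: [:: 0; 2; 1]]);
    rewrite ?jp //=; try lia.
  by case=> [|[|//]] _; rewrite ?addn0 ?addn1 ?prednK //=; apply/negbTE.
apply: (@greedy_dominates _ j.-1 false false [:: false; false; false] [:: [:: 0; 2; 1; 3]]);
  rewrite ?jp //=; try lia.
by case=> [|[|[|//]]] _; rewrite ?addn0 ?addn1 ?addn2 ?prednK //=; apply/negbTE.
Qed.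

(* The rearrangements here and in [ends_run3_dominates] were found by a search. *)
Lemma ends_long_run_dominates r (T : {set 'I_r}) (j : 'I_r) :
  ends_long_run r (cut T) j -> dominates (j |: T) T.
Proof.
case/and5P=> j2 jr b2 b1 /and3P[b0 c1 c2].
apply: (@greedy_dominates _ (j - 2) false false [:: false; false; false; true; false]
  [:: [:: 0; 1; 3; 4; 2; 5]; [:: 0; 2; 3; 4; 1; 5]; [:: 0; 1; 3; 2; 4; 5]]) => //=; try lia.
  by rewrite (_ : j - (j - 2) = 2); [vm_compute | lia].
case=> [|[|[|[|[|//]]]]] _ /=.
- by rewrite addn0 (negbTE b2).
- by rewrite (_ : j - 2 + 1 = j - 1) ?(negbTE b1) //; lia.
- by rewrite subnK // (negbTE b0).
- by rewrite (_ : j - 2 + 3 = j + 1) //; lia.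
- by rewrite (_ : j - 2 + 4 = j + 2) ?(negbTE c2) //; lia.
Qed.

Lemma ends_run3_dominates r (T : {set 'I_r}) (j : 'I_r) :
  ends_run3 r (cut T) j -> dominates (j |: T) T.
Proof.
case/and5P=> j3 jr b3 b2 /and5P[b1 b0 c1 c2 c3].
apply: (@greedy_dominates _ (j - 3) false false
  [:: false; true; false; false; true; false; false]
  [:: [:: 0; 1; 3; 4; 2; 5; 6; 7]; [:: 0; 1; 2; 4; 3; 5; 6; 7];
      [:: 0; 1; 3; 4; 5; 2; 6; 7]; [:: 0; 4; 1; 6; 5; 2; 3; 7]]) => //=; try lia.
  by rewrite (_ : j - (j - 3) = 3); [vm_compute | lia].
case=> [|[|[|[|[|[|[|//]]]]]]] _ /=.
- by rewrite addn0 (negbTE b3).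
- by rewrite (_ : j - 3 + 1 = j - 2) //; lia.
- by rewrite (_ : j - 3 + 2 = j - 1) ?(negbTE b1) //; lia.
- by rewrite subnK // (negbTE b0).
- by rewrite (_ : j - 3 + 4 = j + 1) //; lia.
- by rewrite (_ : j - 3 + 5 = j + 2) ?(negbTE c2) //; lia.
- by rewrite (_ : j - 3 + 6 = j + 3) ?(negbTE c3) //; lia.
Qed.

Lemma addable_dominates r (T : {set 'I_r}) (j : 'I_r) :
  addable r (cut T) j -> dominates (j |: T) T.
Proof.
by case/or3P; [apply: isolated_dominates | apply: ends_long_run_dominates
              | apply: ends_run3_dominates].
Qed.

Lemma addable_notin r (T : {set 'I_r}) (j : 'I_r) : addable r (cut T) j -> j \notin T.
Proof.
rewrite -cut_ord => /or3P[/and3P[]//|/and5P[_ _ _ _ /and3P[]//]|].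
by case/and5P=> _ _ _ _ /and5P[].
Qed.

(** * Counting and matching subsets *)

Lemma card_ord_count r (P : pred nat) : #|[set j : 'I_r | P j]| = count P (iota 0 r).
Proof.
by rewrite -val_enum_ord count_map -size_filter cardsE cardE enumT.
Qed.

Lemma card_addable r (T : {set 'I_r}) : 7 * #|T| + 2 <= 2 * r ->
  #|T| < #|[set j : 'I_r | addable r (cut T) j]|.
Proof.
have -> : #|T| = count (cut T) (iota 0 r).
  by rewrite -card_ord_count; apply: eq_card => j; rewrite inE cut_ord.
rewrite card_ord_count; apply: many_addable => x; exact: cut_lt.
Qed.

Theorem theorem6p2 (r i : nat) (hi1 : 1 <= i) (hi2 : 7 * i <= 2 * r + 5) :
  exists phi : {set 'I_r} -> {set 'I_r},
    {in [set T : {set 'I_r} | #|T| == i.-1] &, injective phi} /\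
    (forall T : {set 'I_r}, #|T| = i.-1 -> #|phi T| = i /\ dominates (phi T) T).
Proof.
pose E (T S : {set 'I_r}) := [exists j : 'I_r, addable r (cut T) j && (S == j |: T)].
have [T|S|phi [phi_inj phiE]] :=
    @degree_matching _ _ set0 E [set T : {set 'I_r} | #|T| == i.-1] i hi1.
- rewrite inE => /eqP cT.
  have : 7 * #|T| + 2 <= 2 * r by lia.
  move/card_addable; rewrite cT prednK // => /leq_trans; apply.
  (* Addable cuts lie outside [T], so distinct ones give distinct sets. *)
  rewrite -(@card_in_imset _ _ (fun j => j |: T)).
    apply/subset_leq_card/subsetP=> _ /imsetP[j jadd ->]; rewrite !inE in jadd *.
    by apply/existsP; exists j; rewrite jadd eqxx.
  move=> j k; rewrite !inE => /addable_notin jT /addable_notin kT /setP/(_ j).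
  by rewrite !inE eqxx (negbTE jT) !orbF => /esym/eqP.
(* Every set related to [S] is [S] minus one element; the existence of one also yields
   [#|S| = i]. *)
- have [->|[T0]] := set_0Vmem [set T in [set T : {set 'I_r} | #|T| == i.-1] | E T S].
    by rewrite cards0.
  have TS T : (T \in [set T in [set T : {set 'I_r} | #|T| == i.-1] | E T S]) ->
      #|S| = i /\ exists2 j, j \in S & T = S :\ j.
    rewrite !inE => /andP[/eqP cT /existsP[j /andP[/addable_notin jT /eqP->]]].
    by split; [rewrite cardsU1 jT cT add1n prednK | exists j; rewrite ?setU11 ?setU1K].
  case/TS=> cS _; rewrite -[leqRHS]cS.
  apply: leq_trans (leq_imset_card (fun j => S :\ j) (pred_of_set S)).
  by apply/subset_leq_card/subsetP=> T /TS[_ [j jS ->]]; apply: imset_f.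
exists phi; split=> // T cT.
have /existsP[j /andP[jadd /eqP->]] : E T (phi T) by apply: phiE; rewrite inE cT.
split; last exact: addable_dominates.
by rewrite cardsU1 (addable_notin jadd) cT add1n prednK.
Qed.
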